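(* Let $p(x)=\sum_{j=0}^m a_jx^j$ be a real polynomial with $a_j\ge 0$ for all $j$, and set $\gamma_k=p(k)$ for $k\in\mathbb{N}_0=\{0,1,2,\ldots\}$. For $k\ge 0$ let $$A(k)=\frac{\gamma_0+\gamma_1+\cdots+\gamma_k}{k+1}.$$ If the average sequence $\{A(k)\}_{k=0}^\infty$ is a multiplier sequence, then so is the sequence $\{\gamma_k\}_{k=0}^\infty$.
   Context: A sequence of real numbers $\{\gamma_k\}_{k=0}^\infty$ is a multiplier sequence if the linear operator $T$ on real polynomials defined by $T[x^k]=\gamma_kx^k$, $k=0,1,2,\ldots$, has the property that $T[p]$ has no non-real zeros whenever the real polynomial $p$ has no non-real zeros (the zero polynomial is regarded as having no non-real zeros). *)

(* Defs.v *)
From HB Require Import structures.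
From mathcomp Require Import all_boot all_order all_algebra.
From mathcomp Require Import reals complex.

Set Implicit Arguments.
Unset Strict Implicit.
Unset Printing Implicit Defensive.

Import Order.TTheory GRing.Theory Num.Theory.
Local Open Scope ring_scope.

(* The zero polynomial is conventionally counted as having only real zeros,
   although every complex number is a root of it. *)
Definition no_nonreal_zeros (R : realType) (q : {poly R}) : Prop :=
  q = 0 \/
  forall z : R[i], root (map_poly (real_complex R) q) z -> complex.Im z = 0.

Definition diag_op (R : realType) (gamma : nat -> R) (q : {poly R}) : {poly R} :=
  \poly_(k < size q) (gamma k * q`_k).

(* [diag_op gamma] is the linear operator determined by
   ['X^k |-> gamma k *: 'X^k]; see [diag_op_is_linear] and [diag_opXn]. *)
Lemma coef_diag_op (R : realType) (gamma : nat -> R) (q : {poly R}) (k : nat) :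
  (diag_op gamma q)`_k = gamma k * q`_k.
Proof.
by rewrite coef_poly; case: ltnP => // le_qk; rewrite nth_default ?mulr0.
Qed.

Lemma diag_op_is_linear (R : realType) (gamma : nat -> R) :
  linear (diag_op gamma).
Proof.
by move=> c q r; apply/polyP => k; rewrite !(coef_diag_op, coefD, coefZ) mulrDr mulrCA.
Qed.

HB.instance Definition _ (R : realType) (gamma : nat -> R) :=
  GRing.isLinear.Build R {poly R} {poly R} _ (diag_op gamma)
    (diag_op_is_linear gamma).

Lemma diag_opXn (R : realType) (gamma : nat -> R) (k : nat) :
  diag_op gamma 'X^k = gamma k *: 'X^k.
Proof.
apply/polyP => j; rewrite coef_diag_op coefZ coefXn.
by case: eqP => [->|]; rewrite ?mulr0.
Qed.

Definition multiplier_sequence (R : realType) (gamma : nat -> R) : Prop :=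
  forall q : {poly R},
    no_nonreal_zeros q -> no_nonreal_zeros (diag_op gamma q).

Definition average_sequence (R : realType) (gamma : nat -> R) (k : nat) : R :=
  (\sum_(j < k.+1) gamma j) / k.+1%:R.

(* Main.v *)
Require Import Defs.
From HB Require Import structures.
From mathcomp Require Import all_boot all_order all_algebra.
From mathcomp Require Import reals complex.
From mathcomp Require Import zify ring lra.

(** Write p in the Newton basis, p(k) = \sum_j h_j * k ^_ j with
    h(x) = \sum_j h_j x^j; the h_j are nonnegative because the coefficients of p
    are ([poly_falling]).  Then the averages are A(k) = \sum_j g_j * k ^_ j with
    g_j = h_j / (j + 1), which says that h = (X g)' ([average_falling]).  Hence
    everything follows, by Rolle's theorem, from a special case of the
    Polya-Schur characterization: for a polynomial g with nonnegative
    coefficients, the sequence \sum_j g_j * k ^_ j is a multiplier sequence if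
    and only if g has only real zeros.

    Necessity ([multiplier_falling_real_rooted]): the image of (1 + x)^n is, up to
    the factor (1 + x)^n and a real Moebius change of variable, the polynomial
    \sum_j g_j * (n ^_ j / n^j) * y^j, which is therefore real-rooted.  As n grows
    it tends to g coefficientwise with bounded degree, and real-rootedness passes
    to such limits ([real_rooted_limit]).

    Sufficiency ([falling_multiplier]): the operator attached to h sends f to
    \sum_j h_j x^j f^(j)(x), whose value at z is that of h(z d/dx) f.
    For z in the upper half-plane, each factor z d/dx + s of h(z d/dx), with
    s >= 0, maps polynomials without zeros in the upper half-plane to such
    polynomials or to zero ([upper_stable_derivB]), so z is not a zero. *)

Set Implicit Arguments.
Unset Strict Implicit.
Unset Printing Implicit Defensive.

Import Order.TTheory GRing.Theory Num.Theory.
Local Open Scope ring_scope.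

(** * Umbral substitution *)

(** The umbral substitution 'X^j |-> u j.  One linear functional covers the
    Newton expansions on nat (u j a falling factorial) and the differential
    operators q(z d/dx) applied to a polynomial (u j a scaled j-th derivative),
    so the recursion rules in q are proved once for both. *)
Definition umbral (R : nzRingType) (V : lmodType R) (u : nat -> V)
    (q : {poly R}) : V := \sum_(j < size q) q`_j *: u j.

Section Umbral.
Variables (R : nzRingType) (V : lmodType R).
Implicit Types (u : nat -> V) (q : {poly R}).

Lemma umbral_widen u q n : (size q <= n)%N ->
  umbral u q = \sum_(j < n) q`_j *: u j.
Proof.
move=> le_q; rewrite /umbral (big_ord_widen n (fun j => q`_j *: u j) le_q).
rewrite big_mkcond; apply: eq_bigr => j _.
by case: ltnP => // le_qj; rewrite nth_default ?scale0r.
Qed.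

Lemma umbral_is_linear u : linear (umbral u).
Proof.
move=> c q r; pose n := maxn (size q) (size r).
have qn : (size q <= n)%N by rewrite leq_maxl.
have rn : (size r <= n)%N by rewrite leq_maxr.
have sn : (size (c *: q + r)%R <= n)%N.
  by rewrite (leq_trans (size_polyD _ _)) // geq_max rn (leq_trans (size_scale_leq _ _)).
rewrite !(@umbral_widen _ _ n) // scaler_sumr -big_split /=.
by apply: eq_bigr => j _; rewrite coefD coefZ scalerDl scalerA.
Qed.

HB.instance Definition _ u :=
  GRing.isLinear.Build R {poly R} V _ (umbral u) (umbral_is_linear u).

Lemma umbralMX u q : umbral u (q * 'X) = umbral (u \o S) q.
Proof.
rewrite (@umbral_widen _ _ (size q).+1); last first.
  by rewrite (leq_trans (size_polyMleq _ _)) // size_polyX addn2.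
rewrite big_ord_recl coefMX /= scale0r add0r.
by apply: eq_bigr => j _; rewrite coefMX.
Qed.

Lemma umbralC u c : umbral u c%:P = c *: u 0.
Proof.
by rewrite (@umbral_widen _ _ 1) ?size_polyC_leq1 // big_ord1 coefC.
Qed.

Lemma umbral_deriv u q :
  umbral u q^`() = umbral (fun j => u j.-1 *+ j) q.
Proof.
rewrite (@umbral_widen _ q^`() (size q)); last first.
  have [->|/lt_size_deriv/ltnW//] := eqVneq q 0.
  by rewrite deriv0.
rewrite (@umbral_widen _ q (size q).+1) // big_ord_recl mulr0n scaler0 add0r.
by apply: eq_bigr => j _; rewrite coef_deriv -scalerMnl -scalerMnr.
Qed.

Lemma eq_umbral u v q : u =1 v -> umbral u q = umbral v q.
Proof. by move=> uv; apply: eq_bigr => j _; rewrite uv. Qed.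

End Umbral.

Lemma umbral_XsubCM (R : comNzRingType) (V : lmodType R) (u : nat -> V)
    (r : R) (q : {poly R}) :
  umbral u (('X - r%:P) * q) = umbral (fun j => u j.+1 - r *: u j) q.
Proof.
rewrite mulrBl mulrC mul_polyC linearB linearZ /= umbralMX /umbral.
rewrite scaler_sumr -sumrB; apply: eq_bigr => j _ /=.
by rewrite scalerBr !scalerA mulrC.
Qed.

(** * Falling factorials and derivatives *)

Lemma ffact_sum n j : (j.+1 * \sum_(i < n) i ^_ j = n ^_ j.+1)%N.
Proof.
elim: n => [|n IH]; first by rewrite big_ord0 muln0.
rewrite big_ord_recr /= mulnDr IH ffactSS ffactnSr mulnC -mulnDl.
by case: (ltnP n j) => nj; [rewrite ffact_small ?muln0 | congr (_ * _)%N; lia].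
Qed.

(** The ratio is the product of the 1 - i/n for i < j, and the sum of these i is
    at most j^2. *)
Lemma ffact_ratio_bounds (R : realFieldType) (n j : nat) : (0 < n)%N ->
  1 - (j ^ 2)%:R / n%:R <= (n ^_ j)%:R / n%:R ^+ j :> R /\
  (n ^_ j)%:R / n%:R ^+ j <= 1 :> R.
Proof.
move=> n0; have n0R : 0 < n%:R :> R by rewrite ltr0n.
elim: j => [|j [IH1 IH2]]; first by rewrite mul0r subr0 divr1 lexx.
set a := _ / n%:R ^+ j in IH1 IH2.
have a0 : 0 <= a by rewrite divr_ge0 // exprn_ge0.
have -> : (n ^_ j.+1)%:R / n%:R ^+ j.+1 = a * ((n - j)%:R / n%:R) :> R.
  by rewrite /a ffactnSr natrM exprS; field; rewrite gt_eqF //= expf_neq0 // gt_eqF.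
pose t : R := (n - j)%:R / n%:R.
have t1 : t <= 1 by rewrite ler_pdivrMr // mul1r ler_nat leq_subr.
have t0 : 0 <= t by rewrite divr_ge0.
have tj : 1 - j%:R / n%:R <= t.
  rewrite -[leLHS](mulfK (lt0r_neq0 n0R)) ler_pM2r ?invr_gt0 // mulrBl mul1r divfK ?gt_eqF //.
  by rewrite lerBlDr -natrD ler_nat; lia.
rewrite -/t; split; last by rewrite mulr_ile1.
(* Both a and t are at most 1, so a t >= a + t - 1. *)
have : a - j%:R / n%:R <= a * t.
  have : 0 <= (1 - a) * (1 - t) by rewrite mulr_ge0 ?subr_ge0.
  by rewrite mulrBl !mulrBr; lra.
have : (j.+1 ^ 2)%:R / n%:R = (j ^ 2)%:R / n%:R + 2 * (j%:R / n%:R) + 1 / n%:R :> R.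
  by rewrite !natrX -natr1; field; rewrite gt_eqF.
have : 0 <= 1 / n%:R :> R by rewrite divr_ge0.
have : 0 <= j%:R / n%:R :> R by rewrite divr_ge0.
lra.
Qed.

Lemma deriv_prod_XsubC (F : fieldType) (rs : seq F) (x : F) :
    x \notin rs ->
  (\prod_(r <- rs) ('X - r%:P))^`().[x] =
    (\prod_(r <- rs) ('X - r%:P)).[x] * \sum_(r <- rs) (x - r)^-1.
Proof.
elim: rs => [|r rs IH]; first by rewrite !big_nil derivC horner0 mulr0.
rewrite inE negb_or => /andP[xr /IH {}IH]; rewrite !big_cons derivM derivXsubC mul1r.
rewrite hornerD !hornerM IH hornerXsubC; field.
by rewrite subr_eq0.
Qed.

Lemma derivn_exp_XsubC (F : comNzRingType) (c : F) n j :
  (('X - c%:P) ^+ n)^`(j) = ('X - c%:P) ^+ (n - j) *+ n ^_ j.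
Proof.
elim: j => [|j IH]; first by rewrite derivn0 subn0.
rewrite derivnS IH derivMn deriv_exp derivXsubC mul1r -mulrnA ffactnSr mulnC.
by rewrite subnS.
Qed.

Lemma horner_ge0_gt0 (R : numDomainType) (h : {poly R}) (x : R) :
  (forall j, 0 <= h`_j) -> h != 0 -> 0 < x -> 0 < h.[x].
Proof.
move=> h0 nzh x0; rewrite horner_coef.
have sh : (0 < size h)%N by rewrite size_poly_gt0.
have lt_s : ((size h).-1 < size h)%N by rewrite prednK.
rewrite (bigD1 (Ordinal lt_s)) //= ltr_wpDr ?sumr_ge0 // => [j _|].
  by rewrite mulr_ge0 // exprn_ge0 // ltW.
by rewrite mulr_gt0 ?exprn_gt0 // lt_def h0 -[_ != 0]/(lead_coef h != 0) lead_coef_eq0 nzh.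
Qed.

(** * Polynomials without zeros in the upper half-plane *)

Section UpperHalfPlane.
Variable R : rcfType.
Local Notation C := R[i].
Implicit Types (z w : C) (K L : {poly C}).
Local Notation Im := complex.Im.

Lemma ImD z w : Im (z + w) = Im z + Im w.
Proof. by case: z w => a b []. Qed.

Lemma ImN z : Im (- z) = - Im z. Proof. by case: z. Qed.

Lemma Im_inv_lt0 z : 0 < Im z -> Im z^-1 < 0.
Proof.
case: z => a b /= b0; rewrite oppr_lt0 divr_gt0 //.
by rewrite ltr_wpDl ?sqr_ge0 // exprn_gt0.
Qed.

Lemma normc_real (x : R) : `|x%:C%C| = `|x|%:C%C.
Proof. by rewrite normc_def /= expr0n addr0 sqrtr_sqr. Qed.

(** The zero polynomial is included so that the property is preserved by
    differentiation and by scaling. *)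
Definition upper_stable K :=
  K = 0 \/ forall z, 0 < Im z -> ~~ root K z.

(** The Gauss-Lucas argument: at z in the upper half-plane K'/K is the sum of
    the 1/(z - r) over the roots r of K, all of which lie in the closed lower
    half-plane, so its imaginary part is negative as soon as K is not constant.
    It cannot be equal to w. *)
Lemma upper_stable_derivB K w :
  0 <= Im w -> upper_stable K -> upper_stable (K^`() - w *: K).
Proof.
move=> w0 [->|sK]; first by left; rewrite deriv0 scaler0 subr0.
have [rs defK] := closed_field_poly_normal K.
have [K0|nzK] := eqVneq (lead_coef K) 0.
  by rewrite defK K0 !scale0r deriv0 scaler0 subr0; left.
have rsP r : r \in rs -> Im r <= 0.
  move=> rrs; rewrite leNgt; apply/negP => /sK/negP[].
  by rewrite defK rootZ // root_prod_XsubC.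
have {sK}nrs z : 0 < Im z -> z \notin rs.
  by move=> z0; apply/negP => /rsP; rewrite leNgt z0.
case: rs => [|r rs] in defK rsP nrs *.
  rewrite defK big_nil derivZ derivC scaler0 sub0r alg_polyC scale_polyC -polyCN.
  have [->|nz] := eqVneq (- (w * lead_coef K)) 0; first by left.
  by right=> z _; rewrite rootC.
right=> z z0; rewrite defK derivZ /root !hornerE deriv_prod_XsubC ?nrs //.
set P := _.[z]; set s := \sum_(_ <- _) _.
have nzP : P != 0 by rewrite -[_ == 0]/(root _ z) root_prod_XsubC nrs.
have Ims (t : seq C) : (forall r, r \in t -> Im r <= 0) ->
    Im (\sum_(r <- t) (z - r)^-1) <= 0.
  elim: t => [|x t IH] Ht; first by rewrite big_nil.
  rewrite big_cons ImD -[leRHS]addr0 lerD ?IH // => [|y yt]; last by rewrite Ht // inE yt orbT.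
  by rewrite ltW // Im_inv_lt0 // ImD ImN ltr_wpDr // oppr_ge0 Ht // mem_head.
have s0 : Im s < 0.
  rewrite /s big_cons ImD ltr_wnDr //.
    by rewrite Ims // => y yt; rewrite rsP // inE yt orbT.
  by rewrite Im_inv_lt0 // ImD ImN ltr_wpDr // oppr_ge0 rsP // mem_head.
rewrite [X in X != 0](_ : _ = lead_coef K * P * (s - w)); last by rewrite /=; ring.
rewrite !mulf_neq0 // subr_eq0; apply/eqP => sw.
by move: s0; rewrite sw ltNge w0.
Qed.

Lemma upper_stableZ K w : upper_stable K -> upper_stable (w *: K).
Proof.
have [->|nzw] := eqVneq w 0; first by rewrite scale0r; left.
move=> [->|sK]; first by rewrite scaler0; left.
by right=> z /sK; rewrite rootZ.
Qed.

(** Factor q into the X - r with r <= 0.  The factor X - r contributes the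
    operator z d/dx - r = z (d/dx - r/z), and Im (r/z) >= 0 because r <= 0 and
    z is in the upper half-plane: each factor preserves stability by
    [upper_stable_derivB].  The point z is fixed throughout; it is substituted
    for the variable only afterwards. *)
Lemma upper_stable_umbral_derivn z (q : {poly C}) K :
    0 < Im z -> (forall r, root q r -> r <= 0) -> upper_stable K ->
  upper_stable (umbral (fun j => z ^+ j *: K^`(j)) q).
Proof.
move=> z0 rq.
have [rs defq] := closed_field_poly_normal q.
have [q0|nzq] := eqVneq (lead_coef q) 0.
  by rewrite defq q0 scale0r linear0; left.
have {}rq r : r \in rs -> r <= 0.
  by move=> rrs; apply: rq; rewrite defq rootZ // root_prod_XsubC.
rewrite defq linearZ /= => sK; apply: upper_stableZ.
elim: rs rq K sK {defq} => [|r rs IH] rq K sK.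
  by rewrite big_nil umbralC expr0 !scale1r derivn0.
have nzz : z != 0 by apply: contraTneq z0 => ->; rewrite ltxx.
rewrite big_cons umbral_XsubCM.
under eq_umbral => j.
  rewrite (_ : _ - _ = z ^+ j *: (z *: (K^`() - (r / z) *: K))^`(j)); last first.
    rewrite derivnZ derivnB derivnZ -derivSn exprS.
    rewrite !scalerBr !scalerA; congr (_ *: _ - _ *: _); by field.
  over.
apply: IH => [x xrs|]; first by rewrite rq // inE xrs orbT.
apply/upper_stableZ/upper_stable_derivB => //.
have := rq r (mem_head _ _); rewrite lecE => /andP[/eqP Ir Rr].
have := Im_inv_lt0 z0; move: Ir Rr; case: (r) (z^-1) => a b [c d] /= <- a0 d0.
by rewrite mul0r addr0 mulr_le0 // ltW.
Qed.

(** No cancellation can occur in q(z d/dx) K = 0.  If j is the least index whose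
    term q_j z^j K^(j) is nonzero, then this term has degree deg K - j,
    whereas all later terms have smaller degree.  This rules out that the
    operator kills K for one particular z only. *)
Lemma umbral_derivn_eq0 z (q : {poly C}) K j : z != 0 ->
  umbral (fun j => z ^+ j *: K^`(j)) q = 0 -> q`_j *: K^`(j) = 0.
Proof.
move=> nzz sum0; elim/ltn_ind: j => j IH.
have [->|nzqj] := eqVneq q`_j 0; first by rewrite scale0r.
have [->|nzKj] := eqVneq K^`(j) 0; first by rewrite scaler0.
have le_jd : (j < size K)%N.
  by rewrite ltnNge; apply: contra nzKj => /derivn_poly0->.
have ltj : (j < size q)%N.
  by rewrite ltnNge; apply: contra nzqj => /(nth_default 0)->.
pose d := (size K).-1.
have dE : (size K = d.+1)%N by rewrite prednK // (leq_ltn_trans _ le_jd).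
have /(congr1 (fun p : {poly C} => p`_(d - j))) := sum0.
(* The coefficient of degree deg K - j sees only the j-th term. *)
rewrite coef0 coef_sum (bigD1 (Ordinal ltj)) //= big1 ?addr0 => [|[i lti] /= nij].
  rewrite !coefZ coef_derivn subnKC; last by rewrite -ltnS -dE.
  move/eqP; rewrite mulf_eq0 (negPf nzqj) mulf_eq0 expf_eq0 (negPf nzz) andbF /=.
  rewrite -mulr_natr mulf_eq0 pnatr_eq0 -leqn0 leqNgt ffact_gt0 -ltnS -dE le_jd orbF.
  by rewrite -[K`_d]/(lead_coef K) lead_coef_eq0 -size_poly_eq0 dE.
have [lt_ij|lt_ji|eij] := ltngtP i j; last by rewrite -val_eqE /= eij eqxx in nij.
  by rewrite scalerA mulrC -scalerA IH // scaler0 coef0.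
rewrite !coefZ coef_derivn [K`__]nth_default ?mul0rn ?mulr0 //.
by rewrite dE in le_jd *; lia.
Qed.

End UpperHalfPlane.

(** * Real-rooted real polynomials *)

Section RealPolynomials.
Variable R : realType.
Local Notation C := R[i].
Local Notation Im := complex.Im.
Local Notation toC := (map_poly (real_complex R)).
Implicit Types (h f g : {poly R}) (z : C).

(** The nonreal zeros of a real polynomial come in conjugate pairs, so the upper
    half-plane alone decides. *)
Lemma no_nonreal_zerosP (q : {poly R}) :
  no_nonreal_zeros q <-> upper_stable (map_poly (real_complex R) q).
Proof.
split=> [[->|rq]|[q0|sq]].
- by left; rewrite rmorph0.
- by right=> z z0; apply/negP => /rq zr; rewrite zr ltxx in z0.
- left; apply/(map_poly_inj (real_complex R)); by rewrite q0 rmorph0.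
right=> z rz; have [/sq/negP|z0|//] := ltgtP 0 (Im z); first by case.
have /sq/negP[] : 0 < Im (conjc z).
  by move: z0; case: (z) => a b /=; rewrite oppr_gt0.
rewrite -complex_root_conj -map_poly_comp.
by rewrite (eq_map_poly (g := real_complex R)) // => x; apply: conjc_real.
Qed.

(** Rolle's theorem in its Gauss-Lucas form: the case w = 0 of
    [upper_stable_derivB]. *)
Lemma no_nonreal_zeros_deriv (q : {poly R}) :
  no_nonreal_zeros q -> no_nonreal_zeros q^`().
Proof.
move=> /no_nonreal_zerosP sq; apply/no_nonreal_zerosP.
have := @upper_stable_derivB R _ 0 (lexx 0) sq.
by rewrite scale0r subr0 deriv_map.
Qed.

Lemma no_nonreal_zerosXM (q : {poly R}) :
  no_nonreal_zeros q -> no_nonreal_zeros ('X * q).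
Proof.
case=> [->|rq]; first by left; rewrite mulr0.
right=> z; rewrite rmorphM /= map_polyX rootM => /orP[|/rq//].
by rewrite rootX => /eqP->.
Qed.

Lemma norm_prod_XsubC_ge (rs : seq C) z :
    (forall r, r \in rs -> Im r = 0) ->
  (`|Im z|%:C)%C ^+ size rs <= `|(\prod_(r <- rs) ('X - r%:P)).[z]|.
Proof.
elim: rs => [|r rs IH] Hrs; first by rewrite big_nil hornerC normr1.
rewrite big_cons exprS hornerM normrM hornerXsubC.
have Ir : Im r = 0 by rewrite Hrs ?mem_head.
apply: ler_pM; rewrite ?exprn_ge0 ?ler0c ?normr_ge0 //; last first.
  by apply: IH => x xrs; rewrite Hrs // inE xrs orbT.
have := normc_ge_Re ((z - r) * 'i%C).
rewrite ReiNIm normrN ImD ImN Ir subr0 normrM => /le_trans; apply.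
by rewrite -[leRHS]mulr1 ler_wpM2l // normc_def /= expr0n expr1n add0r sqrtr1.
Qed.

(** Every factor |z - r| with r real is at least |Im z|.  This quantitative form
    of real-rootedness survives passage to the limit. *)
Lemma norm_horner_real_rooted_ge (q : {poly R}) z :
    (forall r, root (toC q) r -> Im r = 0) ->
  (`|lead_coef q| * `|Im z| ^+ (size q).-1)%:C%C <= `|(toC q).[z]|.
Proof.
have [->|nzq] := eqVneq q 0.
  by rewrite lead_coef0 normr0 mul0r normr_ge0.
have [rs defq] := closed_field_poly_normal (toC q) => rq.
have lcq : lead_coef (toC q) = (lead_coef q)%:C%C by rewrite lead_coef_map.
have sz : size q = (size rs).+1.
  rewrite -(size_map_poly (real_complex R)) defq size_scale ?size_prod_XsubC //.
  by rewrite lead_coef_eq0 map_poly_eq0.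
rewrite defq hornerZ normrM lcq sz rmorphM rmorphXn /= ler_pM ?exprn_ge0 ?ler0c //.
  by rewrite normc_real.
apply: norm_prod_XsubC_ge => r rrs; apply: rq.
by rewrite defq rootZ ?root_prod_XsubC // lead_coef_eq0 map_poly_eq0.
Qed.

(** A Hurwitz theorem without complex analysis.  If g vanished at a nonreal y,
    the approximants q would satisfy |q(y)| <= e * \sum_j |y|^j, against the lower
    bound |lead q| * |Im y|^m, which stays away from 0 because the coefficient of
    degree m = deg g converges to that of g.  The bound on the size keeps roots
    from escaping to infinity. *)
Lemma real_rooted_limit (g : {poly R}) :
    (forall e : R, 0 < e -> exists q : {poly R},
      [/\ no_nonreal_zeros q, (size q <= size g)%N
        & forall j, `|q`_j - g`_j| <= e]) ->
  no_nonreal_zeros g.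
Proof.
move=> approx; have [->|nzg] := eqVneq g 0; first by left.
right=> y /eqP gy0; apply/eqP; apply/negP => /negP nzy.
set m := (size g).-1.
have sg : size g = m.+1 by rewrite prednK // size_poly_gt0.
have gm : 0 < `|g`_m| by rewrite normr_gt0 -[_ == 0]/(lead_coef g == 0) lead_coef_eq0.
pose b := `|Im y| ^+ m.
have b0 : 0 < b by rewrite exprn_gt0 // normr_gt0.
have [a yE] : exists a : R, `|y| = a%:C%C by eexists; exact: normc_def.
have a0 : 0 <= a by rewrite -ler0c -yE normr_ge0.
pose s := \sum_(j < m.+1) a ^+ j.
have s0 : 0 <= s by apply: sumr_ge0 => j _; rewrite exprn_ge0.
(* Chosen so that e * s is strictly below (|g_m| - e) * b. *)
pose e := `|g`_m| * b / (2 * (b + s)).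
have e0 : 0 < e by rewrite divr_gt0 ?mulr_gt0 ?ltr_wpDr.
have eE : e * (b + s) * 2 = `|g`_m| * b.
  by rewrite /e; field; rewrite gt_eqF // ltr_wpDr.
have [q [rq sq qg]] := approx e e0.
have qm : `|g`_m| - e <= `|q`_m|.
  have := ler_normB (q`_m) (q`_m - g`_m).
  rewrite opprB addrC subrK => /le_trans h; rewrite lerBlDr; apply: h.
  by rewrite lerD.
have ltem : e < `|g`_m|.
  rewrite -(ltr_pM2r b0) -eE.
  have : 0 < e * b by rewrite mulr_gt0.
  have : 0 <= e * s by rewrite mulr_ge0 // ltW.
  rewrite !mulrDr !mulrDl; lra.
have nzqm : q`_m != 0 by rewrite -normr_gt0 (lt_le_trans _ qm) // subr_gt0.
have szq : size q = m.+1.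
  apply/eqP; rewrite eqn_leq -{1}sg sq ltnNge.
  by apply: contra nzqm => /leq_sizeP/(_ m (leqnn m))->.
have nzq : q != 0 by rewrite -size_poly_eq0 szq.
have {}rq r : root (toC q) r -> Im r = 0.
  by case: rq => [q0|]; [rewrite q0 eqxx in nzq | apply].
have lower := norm_horner_real_rooted_ge y rq.
have upper : `|(toC q).[y]| <= (e * s)%:C%C.
  have -> : (toC q).[y] = \sum_(j < m.+1) (q`_j - g`_j)%:C%C * y ^+ j.
    rewrite -[LHS]subr0 -{}[X in _ - X]gy0.
    rewrite !(@horner_coef_wide _ m.+1) ?size_map_poly ?sg ?szq // -sumrB.
    by apply: eq_bigr => j _; rewrite !coef_map rmorphB mulrBl.
  apply: le_trans (ler_norm_sum _ _ _) _; rewrite /s mulr_sumr rmorph_sum.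
  apply: ler_sum => j _; rewrite normrM normrX yE normc_real rmorphM /= -rmorphXn.
  by rewrite ler_wpM2r ?lecR ?ler0c ?exprn_ge0.
have := le_trans lower upper; rewrite lecR szq /lead_coef szq /= -/b.
have : (`|g`_m| - e) * b <= `|q`_m| * b by rewrite ler_wpM2r // ltW.
have : 0 < e * b by rewrite mulr_gt0.
have : 0 <= e * s by rewrite mulr_ge0 // ltW.
by move: eE; rewrite !mulrDr !mulrBl !mulrDl; lra.
Qed.

(** * Sequences given by Newton expansions *)

(** Polynomial sequences in the Newton basis, with the k ^_ j in place of the
    binomials: h is then the polynomial for which
    \sum_k falling h k * x^k / k! = e^x * h(x). *)
Definition falling h (k : nat) : R := \sum_(j < size h) h`_j * (k ^_ j)%:R.

(** The diagonal operator x^k |-> k ^_ j x^k is x^j (d/dx)^j. *)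
Lemma diag_op_falling h f :
  diag_op (falling h) f = umbral (fun j => 'X^j * f^`(j)) h.
Proof.
apply/polyP => k; rewrite coef_diag_op /falling /umbral coef_sum mulr_suml.
apply: eq_bigr => j _; rewrite coefZ coefXnM coef_derivn.
case: ltnP => [lt_kj|le_jk]; first by rewrite ffact_small // mulr0 mul0r.
by rewrite subnKC // -[in RHS]mulr_natl mulrA.
Qed.

Lemma diag_op_falling_horner h f z :
  (toC (diag_op (falling h) f)).[z] =
  (umbral (fun j => z ^+ j *: (toC f)^`(j)) (toC h)).[z].
Proof.
rewrite diag_op_falling /umbral rmorph_sum !horner_sum size_map_poly.
apply: eq_bigr => j _; rewrite /= map_polyZ rmorphM /= map_polyXn -derivn_map.
by rewrite !(hornerE, hornerXn) coef_map.
Qed.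

Lemma falling_gt0 (g : {poly R}) n :
  (forall j, 0 <= g`_j) -> g != 0 -> (size g <= n)%N -> 0 < falling g n.
Proof.
move=> g0 nzg le_gn; have sg : (0 < size g)%N by rewrite size_poly_gt0.
have ltm : ((size g).-1 < size g)%N by rewrite prednK.
rewrite /falling (bigD1 (Ordinal ltm)) //= ltr_wpDr ?sumr_ge0 // => [j _|].
  by rewrite mulr_ge0.
rewrite mulr_gt0 ?ltr0n ?ffact_gt0 ?(leq_trans _ le_gn) ?leq_pred //.
by rewrite lt_def g0 -[_ != 0]/(lead_coef g != 0) lead_coef_eq0 nzg.
Qed.

Lemma fallingE h k : falling h k = umbral (fun j => (k ^_ j)%:R : R^o) h.
Proof. by []. Qed.

(** Multiplication by k sends k ^_ j to k ^_ j.+1 + j * k ^_ j, that is, it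
    replaces h by X * (h + h'); nonnegativity of the coefficients is preserved. *)
Lemma poly_falling (p : {poly R}) : (forall j, 0 <= p`_j) ->
  exists2 h : {poly R}, forall j, 0 <= h`_j & forall k, p.[k%:R] = falling h k.
Proof.
elim/poly_ind: p => [|p c IH] p0.
  by exists 0 => [j|k]; rewrite ?coef0 // horner0 /falling size_poly0 big_ord0.
have [|h h0 ph] := IH.
  by move=> j; have := p0 j.+1; rewrite coefD coefMX coefC addr0.
exists ((h + h^`()) * 'X + c%:P) => [j|k].
  rewrite coefD coefMX coefC; case: j => [|j] /=.
    by have := p0 0; rewrite coefD coefMX coefC.
  by rewrite addr0 coefD coef_deriv addr_ge0 ?mulrn_wge0.
rewrite hornerMXaddC ph !fallingE linearD /= umbralMX umbralC.
rewrite linearD /= umbral_deriv; congr (_ + _); last by rewrite [RHS]mulr1.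
rewrite /umbral mulr_suml -big_split /=; apply: eq_bigr => j _.
rewrite -scalerDr -[LHS]mulrA; congr (_ * _); rewrite -natrM.
case: j => -[|j] /= _; first by rewrite ffactn0 mulr0n addr0 ffactnS ffactn0 muln1 mul1n.
rewrite -mulrnA -natrD; congr _%:R.
rewrite [in RHS](ffactnSr _ j.+1) -mulnDr.
by case: (ltnP k j.+1) => jk; [rewrite ffact_small | rewrite subnK].
Qed.

(** Averaging acts on Newton coefficients by g_j = h_j / (j + 1), because
    k ^_ j summed over k is (k + 1) ^_ (j + 1) / (j + 1) = (k + 1) * k ^_ j / (j + 1).
    Inverting it gives h = (X g)'. *)
Lemma average_falling (g : {poly R}) k :
  average_sequence (falling ('X * g)^`()) k = falling g k.
Proof.
rewrite /average_sequence.
have fE i : falling ('X * g)^`() i = \sum_(j < size g) (g`_j *+ j.+1) * (i ^_ j)%:R.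
  rewrite fallingE (@umbral_widen _ _ _ _ (size g)).
    by apply: eq_bigr => j _; rewrite coef_deriv coefXM.
  by apply/leq_sizeP => j lej; rewrite coef_deriv coefXM /= nth_default ?mul0rn.
under eq_bigr do rewrite fE.
rewrite exchange_big mulr_suml; apply: eq_bigr => j _ /=.
rewrite -mulr_sumr -natr_sum -(mulr_natr g`_j) -(mulrA g`_j) -natrM.
by rewrite ffact_sum ffactSS natrM; field; rewrite nat1r pnatr_eq0.
Qed.

(** * Real-rootedness and multiplier sequences *)

(** The sufficiency half.  The value at z of the image of f is h(z d/dx) f
    evaluated at z.  The roots of h are real, and nonpositive since its
    coefficients are nonnegative, so h(z d/dx) f, unless it is the zero
    polynomial, has no zero in the upper half-plane, in particular not at z. *)
Lemma falling_multiplier h :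
    (forall j, 0 <= h`_j) -> no_nonreal_zeros h ->
  multiplier_sequence (falling h).
Proof.
move=> h0 rh f /no_nonreal_zerosP sf; apply/no_nonreal_zerosP.
have {}rh r : root (toC h) r -> h != 0 -> r <= 0.
  case: rh => [->|rh]; rewrite ?eqxx // => rr nzh; have := rh _ rr.
  case: r rr => a b /= rr b0; rewrite b0 in rr *.
  have : h.[a] = 0.
    apply: (@complexI R); move/eqP: rr.
    by rewrite -[(a +i* 0)%C]/(a%:C)%C horner_map.
  rewrite lecE /= eqxx /= leNgt => ha; apply/negP => /(horner_ge0_gt0 h0 nzh).
  by rewrite ha ltxx.
have [->|nzT] := eqVneq (diag_op (falling h) f) 0; first by left; rewrite rmorph0.
have nzh : h != 0.
  apply: contraNneq nzT => ->; apply/eqP/polyP => k.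
  by rewrite coef_diag_op /falling size_poly0 big_ord0 mul0r coef0.
right=> z z0; rewrite /root diag_op_falling_horner.
have nzz : z != 0 by apply: contraTneq z0 => ->; rewrite ltxx.
have rqh r : root (toC h) r -> r <= 0 by move=> /rh; apply.
case: (upper_stable_umbral_derivn z0 rqh sf) => [/umbral_derivn_eq0 T0|].
(* If h(z d/dx) f = 0 for this z, all its terms vanish, and then so does the
   image of f. *)
- case/eqP: nzT; rewrite diag_op_falling /umbral big1 // => j _.
  suff -> : h`_j *: ('X^j * f^`(j)) = 0 by [].
  have /(_ j) := T0 _ nzz; rewrite coef_map derivn_map /= -map_polyZ.
  rewrite scalerAr => /eqP; rewrite map_poly_eq0 => /eqP->.
  by rewrite mulr0.
by apply.
Qed.

(** The n-th Jensen polynomial \sum_k 'C(n, k) * (k! g_k) * x^k, rescaled by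
    x |-> x/n so that it converges to g. *)
Definition jensen (g : {poly R}) (n : nat) : {poly R} :=
  \poly_(j < size g) (g`_j * ((n ^_ j)%:R / n%:R ^+ j)).

(** Apply the multiplier sequence to (1 + x)^n.  The j-th term of the image is
    g_j * n ^_ j * x^j * (1 + x)^(n - j), so the image equals (1 + x)^n times the
    Jensen polynomial at y = n x / (1 + x).  This Moebius transformation is real,
    hence matches nonreal points with nonreal points. *)
Lemma jensen_real_rooted (g : {poly R}) (n : nat) :
    (forall j, 0 <= g`_j) -> multiplier_sequence (falling g) ->
    (size g <= n)%N -> no_nonreal_zeros (jensen g n).
Proof.
move=> g0 mg le_gn; have [->|nzg] := eqVneq g 0.
  by left; rewrite /jensen size_poly0 poly_def big_ord0.
have n0 : (0 < n)%N by rewrite (leq_trans _ le_gn) // size_poly_gt0.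
pose f : {poly R} := ('X - (-1)%:P) ^+ n.
have rf : no_nonreal_zeros f.
  right=> z; rewrite rmorphXn rmorphB /= map_polyX map_polyC /= rmorphN1.
  rewrite /root horner_exp hornerXsubC expf_eq0 n0 /= subr_eq0 => /eqP->.
  by rewrite ImN oppr0.
(* The image of f is not zero: its coefficient of degree n is falling g n. *)
have rT z : root (toC (diag_op (falling g) f)) z -> Im z = 0.
  case: (mg f rf) => [T0|]; last exact.
  have := falling_gt0 g0 nzg le_gn.
  have /(congr1 (fun q : {poly R} => q`_n)) := T0.
  rewrite coef_diag_op coef0 (_ : f`_n = 1) ?mulr1 => [->|]; first by rewrite ltxx.
  have := lead_coef_exp ('X - (-1)%:P : {poly R}) n.
  by rewrite lead_coefXsubC expr1n /lead_coef size_exp_XsubC.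
right=> y Qy; apply/eqP; apply/negP => /negP nzy.
have nzny : n%:R - y != 0.
  apply: contraNneq nzy => /eqP; rewrite subr_eq0 => /eqP <-.
  by rewrite -(rmorph_nat (real_complex R)).
have nzn : n%:R != 0 :> C by rewrite pnatr_eq0 -lt0n.
(* The inverse of the transformation y = n z / (1 + z). *)
pose z := y / (n%:R - y).
have z1 : z - (-1) = n%:R / (n%:R - y) by rewrite /z; field.
have yz : n%:R * z / (z + 1) = y.
  by move: z1; rewrite opprK /z => ->; field; rewrite nzny.
have Tz : (toC (diag_op (falling g) f)).[z] = (z - (-1)) ^+ n * (toC (jensen g n)).[y].
  rewrite diag_op_falling_horner /umbral size_map_poly horner_sum.
  rewrite (@horner_coef_wide _ (size g)) ?size_map_poly ?size_poly // mulr_sumr.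
  apply: eq_bigr => j _; rewrite !coef_map coef_poly ltn_ord.
  have le_jn : (j <= n)%N by rewrite (leq_trans _ le_gn) // ltnW.
  have -> : toC f = ('X - (-1)%:P) ^+ n.
    by rewrite rmorphXn rmorphB /= map_polyX map_polyC /= rmorphN1.
  rewrite derivn_exp_XsubC !hornerE hornerMn horner_exp hornerXsubC /=.
  rewrite !rmorphM fmorphV rmorphXn !rmorph_nat /=.
  have -> : (z - (-1)) ^+ n = (z - (-1)) ^+ (n - j) * (z - (-1)) ^+ j.
    by rewrite -exprD subnK.
  rewrite -[in LHS]mulr_natr.
  have -> : z ^+ j = (z - (-1)) ^+ j * y ^+ j / n%:R ^+ j.
    by rewrite -exprMn -exprVn -exprMn z1 /z; congr (_ ^+ _); field; rewrite nzn.
  by ring.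
have /rT Iz : root (toC (diag_op (falling g) f)) z.
  by rewrite /root Tz (eqP Qy) mulr0.
have zE : z = (complex.Re z)%:C%C by rewrite [LHS]complexE Iz mulr0 addr0.
case/eqP: nzy; rewrite -yz zE.
by rewrite -(rmorph_nat (real_complex R)) -(rmorph1 (real_complex R)) -rmorphD -rmorphM -fmorph_div.
Qed.

(** The necessity half: g is the limit of its rescaled Jensen polynomials. *)
Lemma multiplier_falling_real_rooted (g : {poly R}) :
    (forall j, 0 <= g`_j) -> multiplier_sequence (falling g) ->
  no_nonreal_zeros g.
Proof.
move=> g0 mg; apply: real_rooted_limit => e e0.
pose B := \sum_(j < size g) g`_j * (j ^ 2)%:R.
have B0 : 0 <= B by apply: sumr_ge0 => j _; rewrite mulr_ge0.
pose n := (size g + Num.bound (B / e)).+1.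
have n0 : 0 < n%:R :> R by rewrite ltr0n.
have nB : B / n%:R <= e.
  rewrite ler_pdivrMr // mulrC -ler_pdivrMr //.
  apply: le_trans (ltW (archi_boundP _)) _; first by rewrite divr_ge0 // ltW.
  by rewrite ler_nat leqW ?leq_addl.
exists (jensen g n); split; [|exact: size_poly|move=> j].
  by apply: jensen_real_rooted => //; rewrite leqW ?leq_addr.
rewrite coef_poly; case: ltnP => [ltj|lej]; last first.
  by rewrite nth_default // subr0 normr0 ltW.
have [lo hi] := @ffact_ratio_bounds R n j isT.
rewrite -[X in _ - X]mulr1 -mulrBr normrM ger0_norm //.
rewrite ler0_norm ?subr_le0 // opprB (le_trans _ nB) //.
apply: (@le_trans _ _ (g`_j * ((j ^ 2)%:R / n%:R))).
  by rewrite ler_wpM2l // lerBlDr -lerBlDl.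
rewrite mulrA ler_pM2r ?invr_gt0 // /B (bigD1 (Ordinal ltj)) //= lerDl.
by apply: sumr_ge0 => i _; rewrite mulr_ge0.
Qed.

End RealPolynomials.

Lemma eq_multiplier_sequence (R : realType) (a b : nat -> R) :
  a =1 b -> multiplier_sequence a -> multiplier_sequence b.
Proof.
move=> ab ma q /ma; congr no_nonreal_zeros.
by apply/polyP => k; rewrite !coef_diag_op ab.
Qed.

Theorem theorem14 (R : realType) (p : {poly R})
    (hp : forall j : nat, 0 <= p`_j)
    (hA : multiplier_sequence (average_sequence (fun k : nat => p.[k%:R]))) :
  multiplier_sequence (fun k : nat => p.[k%:R]).
Proof.
have [h h0 ph] := poly_falling hp.
pose g := \poly_(j < size h) (h`_j / j.+1%:R).
have g0 j : 0 <= g`_j by rewrite coef_poly; case: ifP => // _; rewrite divr_ge0.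
have hE : h = ('X * g)^`().
  apply/polyP => j; rewrite coef_deriv coefXM /= coef_poly.
  case: ltnP => [_|le]; last by rewrite nth_default ?mul0rn.
  by rewrite -[RHS]mulr_natr divfK // pnatr_eq0.
have mg : multiplier_sequence (falling g).
  apply: eq_multiplier_sequence hA => k; rewrite -average_falling -hE.
  by rewrite /average_sequence; under eq_bigr do rewrite ph.
apply: (@eq_multiplier_sequence _ (falling h)) => [k|]; first by rewrite ph.
apply: falling_multiplier => //; rewrite hE.
exact/no_nonreal_zeros_deriv/no_nonreal_zerosXM/multiplier_falling_real_rooted.
Qed.
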